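(* Let $p$ be a prime, and let $n, r$ be positive integers such that $1\le r\le p-1$. Let $m_1,\ldots,m_{r+np}$ be non-negative integers such that $r+np=\sum_{i=1}^{r+np} i\,m_i$. Let $n^*=n/2$ if $n$ is even, and $n^*=n$ otherwise. 1. If $m_1\ge p(n-m_p)\ge 0$, then $$c_{r+np}(m_1,\ldots,m_{r+np})\equiv (-1)^{p m_p}\binom{n}{m_p}\, c_r(m_1+p m_p-np,\, m_2,\ldots,m_r) \pmod{n^*p\,\mathbb{Z}_p}.$$ 2. Otherwise, $$c_{r+np}(m_1,\ldots,m_{r+np})\equiv 0 \pmod{n^*p\,\mathbb{Z}_p}.$$
   Context: $\mathbb{Z}_p$ denotes the ring of $p$-adic integers. For a positive integer $k$ and non-negative integers $a_1,\ldots,a_k$ with $\sum_{i=1}^k i\,a_i=k$, put $$c_k(a_1,\ldots,a_k)=\frac{k!}{\prod_{i=1}^k i^{a_i}\,(a_i!)},$$ which is an integer (it is the coefficient of $\prod_{i=1}^k X_i^{a_i}$ in the cycle indicator polynomial $C_k$ of the symmetric group $S_k$). *)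

(* Defs.v *)
From HB Require Import structures.
From mathcomp Require Import all_boot all_order all_algebra.
From mathcomp Require Import boolp.

Set Implicit Arguments.
Unset Strict Implicit.
Unset Printing Implicit Defensive.

Import GRing.Theory.
Local Open Scope ring_scope.

(* For p prime, the p-adic integers, as the inverse limit of the rings Z / p^(k+1) along
   the reductions Z / p^(k+2) -> Z / p^(k+1).  The exponents start at 1
   because 'Z_1 is not the zero ring; this does not change the limit. *)
Record padic_int (p : nat) := PadicInt {
  padic_residue :> forall k : nat, 'Z_(p ^ k.+1);
  padic_compat :
    forall k, (padic_residue k.+1 : nat)%:R = padic_residue k }.

Section PadicRing.

Variable p : nat.
Implicit Types x y z : padic_int p.

Lemma padicP x y : (forall k, x k = y k) -> x = y.
Proof.
case: x y => [x cx] [y cy] /= exy.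
have {}exy : x = y by apply: functional_extensionality_dep.
by subst y; congr PadicInt; apply: Prop_irrelevance.
Qed.

Lemma Zp_trunc_dvd k :
  ((Zp_trunc (p ^ k.+1)).+2 %| (Zp_trunc (p ^ k.+2)).+2)%N.
Proof.
case: p => [|[|q]]; rewrite ?exp1n ?exp0n //.
have gt1 j : (1 < q.+2 ^ j.+1)%N by rewrite -{1}(expn0 q.+2) ltn_exp2l.
by rewrite !Zp_cast // dvdn_exp2l.
Qed.

Definition padic_red k (a : 'Z_(p ^ k.+2)) : 'Z_(p ^ k.+1) := (a : nat)%:R.

Lemma padic_red_nat k n : padic_red (n%:R : 'Z_(p ^ k.+2)) = n%:R.
Proof.
apply: val_inj; rewrite /padic_red !Zp_nat /=.
by rewrite modn_dvdm // Zp_trunc_dvd.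
Qed.

Lemma padic_redD k : {morph @padic_red k : a b / a + b}.
Proof.
move=> a b; rewrite -[a]natr_Zp -[b]natr_Zp -natrD.
by rewrite !padic_red_nat natrD.
Qed.

Lemma padic_redM k : {morph @padic_red k : a b / a * b}.
Proof.
move=> a b; rewrite -[a]natr_Zp -[b]natr_Zp -natrM.
by rewrite !padic_red_nat natrM.
Qed.

Lemma padic_redN k : {morph @padic_red k : a / - a}.
Proof.
move=> a; apply/eqP; rewrite -addr_eq0 -padic_redD addNr.
by rewrite (padic_red_nat k 0).
Qed.

Lemma padic_compat0 k : padic_red (0 : 'Z_(p ^ k.+2)) = 0.
Proof. exact: (padic_red_nat k 0). Qed.

Lemma padic_compat1 k : padic_red (1 : 'Z_(p ^ k.+2)) = 1.
Proof. exact: (padic_red_nat k 1). Qed.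

Lemma padic_compatN x k : padic_red (- x k.+1) = - x k.
Proof. by rewrite padic_redN [padic_red _]padic_compat. Qed.

Lemma padic_compatD x y k : padic_red (x k.+1 + y k.+1) = x k + y k.
Proof. by rewrite padic_redD ![padic_red _]padic_compat. Qed.

Lemma padic_compatM x y k : padic_red (x k.+1 * y k.+1) = x k * y k.
Proof. by rewrite padic_redM ![padic_red _]padic_compat. Qed.

Definition padic_zero := @PadicInt p (fun=> 0) padic_compat0.
Definition padic_one := @PadicInt p (fun=> 1) padic_compat1.
Definition padic_opp x := @PadicInt p (fun k => - x k) (padic_compatN x).
Definition padic_add x y :=
  @PadicInt p (fun k => x k + y k) (padic_compatD x y).
Definition padic_mul x y :=
  @PadicInt p (fun k => x k * y k) (padic_compatM x y).

Lemma padic_addA : associative padic_add.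
Proof. by move=> x y z; apply: padicP => k /=; rewrite addrA. Qed.

Lemma padic_addC : commutative padic_add.
Proof. by move=> x y; apply: padicP => k /=; rewrite addrC. Qed.

Lemma padic_add0 : left_id padic_zero padic_add.
Proof. by move=> x; apply: padicP => k /=; rewrite add0r. Qed.

Lemma padic_addN : left_inverse padic_zero padic_opp padic_add.
Proof. by move=> x; apply: padicP => k /=; rewrite addNr. Qed.

Lemma padic_mulA : associative padic_mul.
Proof. by move=> x y z; apply: padicP => k /=; rewrite mulrA. Qed.

Lemma padic_mulC : commutative padic_mul.
Proof. by move=> x y; apply: padicP => k /=; rewrite mulrC. Qed.

Lemma padic_mul1 : left_id padic_one padic_mul.
Proof. by move=> x; apply: padicP => k /=; rewrite mul1r. Qed.

Lemma padic_mulD : left_distributive padic_mul padic_add.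
Proof. by move=> x y z; apply: padicP => k /=; rewrite mulrDl. Qed.

End PadicRing.

HB.instance Definition _ (p : nat) := gen_eqMixin (padic_int p).
HB.instance Definition _ (p : nat) := gen_choiceMixin (padic_int p).

HB.instance Definition _ (p : nat) :=
  GRing.isZmodule.Build (padic_int p)
    (@padic_addA p) (@padic_addC p) (@padic_add0 p) (@padic_addN p).

Lemma padic_one_neq0 (p : nat) : padic_one p != 0.
Proof.
apply/eqP => /(congr1 (fun x : padic_int p => x 0%N)) /= e.
by have := oner_neq0 'Z_(p ^ 1); rewrite e eqxx.
Qed.

HB.instance Definition _ (p : nat) :=
  GRing.Zmodule_isComNzRing.Build (padic_int p)
    (@padic_mulA p) (@padic_mulC p) (@padic_mul1 p) (@padic_mulD p)
    (@padic_one_neq0 p).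

Definition congr_mod (R : comNzRingType) (d x y : R) : Prop :=
  exists z : R, x - y = d * z.

(* Families (a_1, ..., a_k) are represented by functions a : nat -> nat of
   which only the values a 1, ..., a k matter. *)
Definition cycle_weight (k : nat) (a : nat -> nat) : nat :=
  (\sum_(1 <= i < k.+1) i * a i)%N.

(* c_k(a_1, ..., a_k), the coefficient of X_1^a_1 ... X_k^a_k in the cycle
   indicator C_k; it is 0 for the monomials that do not occur in C_k, i.e.
   those with a_1 + 2 a_2 + ... + k a_k <> k.  On the others the natural
   number division is exact, see cycle_coefE. *)
Definition cycle_coef (k : nat) (a : nat -> nat) : nat :=
  if cycle_weight k a == k
  then (k`! %/ \prod_(1 <= i < k.+1) (i ^ a i * (a i)`!))%N
  else 0%N.

Lemma dvdn_expn_fact (i n : nat) : (0 < i)%N ->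
  (i ^ n * n`! %| (i * n)`!)%N.
Proof.
move=> i_gt0; elim: n => [|n IHn]; first by rewrite muln0.
have -> : (i ^ n.+1 * n.+1`! = (i ^ n * n`!) * (i * n.+1))%N.
  by rewrite expnS factS mulnACA mulnC.
have e : (i * n.+1 = (i * n + i.-1).+1)%N.
  by rewrite mulnS addnC -addnS prednK.
rewrite {2}e factS -e mulnC dvdn_mul //.
apply: dvdn_trans IHn _.
by rewrite -(@bin_fact (i * n + i.-1) (i * n)) ?leq_addr // dvdn_mull ?dvdn_mulr.
Qed.

Lemma dvdn_cycle_weight (k : nat) (a : nat -> nat) :
  (\prod_(1 <= i < k.+1) (i ^ a i * (a i)`!) %| (cycle_weight k a)`!)%N.
Proof.
rewrite /cycle_weight; elim: k => [|k IHk]; first by rewrite !big_nil.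
rewrite !(big_nat_recr k.+1) //=.
set S := (\sum_(1 <= i < k.+1) _)%N.
rewrite -(@bin_fact (S + k.+1 * a k.+1) S) ?leq_addr // addKn.
by rewrite dvdn_mull // dvdn_mul // dvdn_expn_fact.
Qed.

Lemma cycle_coefE (k : nat) (a : nat -> nat) : cycle_weight k a = k ->
  (cycle_coef k a * \prod_(1 <= i < k.+1) (i ^ a i * (a i)`!))%N = k`!.
Proof.
move=> wk; rewrite /cycle_coef wk eqxx divnK //.
by have := dvdn_cycle_weight k a; rewrite wk.
Qed.

(* Main.v *)
Require Import Defs.
From mathcomp Require Import all_boot all_order all_algebra.
From mathcomp Require Import zify ring.

Set Implicit Arguments.
Unset Strict Implicit.
Unset Printing Implicit Defensive.

Import Order.TTheory GRing.Theory Num.Theory.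
Local Open Scope ring_scope.

(** Put k = r + n p and let s be the sum of the i m_i over the lengths i other
    than 1 and p, so that m_1 + p m_p + s = k.  As r < p, the main case is
    exactly s <= r.  Integers prime to p are units of the p-adic integers
    ([padic_nat_unit]), so both claims are divisibilities in the integers by
    the p-part of n* p ([padic_congr_mod]).

    Main case.  Every factorial splits as N! = p^q q! U(N) with q the quotient
    of N by p and U(N) the product of the integers up to N prime to p
    ([fact_pfree]).  In k! / (m_1! p^m_p m_p! Z), where Z collects the lengths
    other than 1 and p, the remaining parts form a binomial coefficient:
    c_k U(m_1) Z = 'C(n, m_p) U(k) ([cycle_coef_pfree]), and Z is prime to p
    because it divides r!.  The product U is multiplicative over multiples of
    the modulus, and Wilson's theorem modulo prime powers evaluates U(p N) as
    the sign (-1)^(p N) if p^e divides N ([pfree_prod_sign]), modulo p^(e+1)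
    in general and modulo 2^e if p = 2 and e > 0.  With p^e the p-part common
    to n and m_p, this compares U(k) and U(m_1), and the binomial coefficient
    supplies the missing power of p, since n divides 'C(n, m_p) gcd(n, m_p)
    ([cycle_coef_congr]).  The factor 2 lost if p = 2 and e > 0 is harmless, as
    n is then even and n* = n / 2.

    Vanishing.  For a set A of lengths with w = sum over A of i m_i, the number
    c_k times the product over A of i^m_i m_i! is a multiple of the falling
    factorial k^_w ([dvdn_ffact_cycle_coef]), and if w > p Q + r the latter
    runs through the multiples n p, ..., (n - Q) p of p
    ([dvdn_ffact_multiples]).  If s > r, there is an A for which the
    p-adic valuation of k^_w exceeds that of the product by at least the
    required amount: a single length i with i m_i > r, treated in
    [vanish_coprime_length] and [vanish_multiple_length], or, if there is none,
    all lengths other than 1 and p ([vanish_short_lengths]). *)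

(** * Products of the integers prime to p *)

Definition pfree_prod (p a b : nat) : nat :=
  (\prod_(a <= x < b | ~~ (p %| x)) x)%N.

Lemma fact_pfree (p N : nat) : (0 < p)%N ->
  (N`! = p ^ (N %/ p) * (N %/ p)`! * pfree_prod p 0 N.+1)%N.
Proof.
move=> p_gt0; elim: N => [|N IHN].
  by rewrite div0n /pfree_prod big_mkcond big_nat1 dvdn0 fact0.
rewrite factS IHN /pfree_prod [in RHS]big_mkcond big_nat_recr //=.
rewrite -big_mkcond divnS //=.
case: (boolP (p %| N.+1)%N) => [p_dvd | _] /=; last by rewrite add0n; lia.
have e : (N.+1 = (N %/ p).+1 * p)%N.
  by rewrite -{1}(divnK p_dvd) divnS // p_dvd.
by rewrite add1n expnS factS {1}e muln1; lia.
Qed.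

Lemma coprime_pfree (p a b : nat) : prime p -> coprime p (pfree_prod p a b).
Proof.
move=> p_pr; rewrite /pfree_prod; elim/big_ind: _ => [|x y|x px].
- exact: coprimen1.
- by rewrite coprimeMr => -> ->.
- by rewrite prime_coprime.
Qed.

Lemma pfree_prod_cat (p a b c : nat) : (a <= b)%N -> (b <= c)%N ->
  pfree_prod p a c = (pfree_prod p a b * pfree_prod p b c)%N.
Proof. exact: big_cat_nat. Qed.

Lemma pfree_prod_fact (p r : nat) : (r < p)%N -> pfree_prod p 0 r.+1 = r`!.
Proof.
move=> lt_rp; have p_gt0 : (0 < p)%N by apply: leq_ltn_trans lt_rp.
by rewrite (fact_pfree r p_gt0) divn_small // fact0 !mul1n.
Qed.

Section Periodicity.

Variables (R : comNzRingType) (p t : nat).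
Hypotheses (p_dvd_t : (p %| t)%N) (t_eq0 : t%:R = 0 :> R).

Lemma pfree_prodD (b : nat) :
  (pfree_prod p 0 (t + b))%:R
    = (pfree_prod p 0 t)%:R * (pfree_prod p 0 b)%:R :> R.
Proof.
rewrite (@pfree_prod_cat p 0 t) ?leq_addr // natrM; congr (_ * _).
rewrite /pfree_prod -{1}[t]add0n big_addn addKn !natr_prod.
apply: eq_big => [x | x _]; first by rewrite dvdn_addl.
by rewrite natrD t_eq0 addr0.
Qed.

Lemma pfree_prodM (N : nat) :
  (pfree_prod p 0 (t * N))%:R = (pfree_prod p 0 t)%:R ^+ N :> R.
Proof.
elim: N => [|N IHN]; first by rewrite muln0 /pfree_prod big_geq.
by rewrite mulnS pfree_prodD IHN exprS.
Qed.

End Periodicity.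

Lemma Zp_nat_eq0 (d x : nat) : (1 < d)%N -> (x%:R == 0 :> 'Z_d) = (d %| x)%N.
Proof. by move=> d_gt1; rewrite -val_eqE /= val_Zp_nat. Qed.

Lemma Zp_int_eq0 (d : nat) (z : int) : (1 < d)%N ->
  (z%:~R == 0 :> 'Z_d) = (d %| z)%Z.
Proof.
move=> d_gt1; rewrite dvdzE /=; case: z => x.
  by rewrite Zp_nat_eq0.
by rewrite NegzE mulrNz oppr_eq0 Zp_nat_eq0 // abszN.
Qed.

(** Inversion permutes the units, so their product is its own inverse. *)
Lemma prod_coprime_sqr (d : nat) : (1 < d)%N ->
  (\prod_(0 <= x < d | coprime d x) x)%:R ^+ 2 = 1 :> 'Z_d.
Proof.
case: d => [|[|q]] // d_gt1; set d := q.+2; rewrite natr_prod.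
have -> : \prod_(0 <= x < d | coprime d x) x%:R
    = \prod_(x : 'Z_d | x \is a GRing.unit) x.
  rewrite big_mkord; apply: eq_big => [x | x _]; last exact: natr_Zp.
  by rewrite -[in RHS](natr_Zp x) unitZpE.
rewrite expr2 {2}(reindex_inj invr_inj) /=.
rewrite (eq_bigl _ _ (@unitrV _)) -big_split /=.
by apply: big1 => x; apply: divrr.
Qed.

(** For k > 0, the factors of [pfree_prod p 0 (p ^ k)] are the units modulo
    p^k, see [prod_coprime_sqr]. *)
Lemma pfree_prod_sqr (p k : nat) : prime p -> (0 < k)%N ->
  (p ^ k %| (pfree_prod p 0 (p ^ k)) ^ 2 - 1)%N.
Proof.
move=> p_pr k_gt0.
have d_gt1 : (1 < p ^ k)%N by rewrite -(exp1n k) ltn_exp2r ?prime_gt1.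
rewrite -Zp_nat_eq0 // natrB; last first.
  rewrite expn_gt0 lt0n; apply/orP; left; apply/eqP => P0.
  by have := coprime_pfree 0 (p ^ k) p_pr; rewrite P0 prime_coprime ?dvdn0.
rewrite natrX subr_eq0; apply/eqP/(etrans _ (prod_coprime_sqr d_gt1)).
rewrite /pfree_prod; congr (_%:R ^+ 2); apply: eq_bigl => x.
by rewrite coprime_pexpl // prime_coprime.
Qed.

(** Wilson's theorem modulo p^k.  The product W satisfies W^2 = 1 and, being
    a power of (p-1)! with odd exponent modulo p, W = -1 modulo p; thus W - 1 is
    prime to p when p is odd, and (W - 1)(W + 1) = 0 forces W = -1. *)
Lemma pfree_prod_odd (p k : nat) : prime p -> odd p -> (0 < k)%N ->
  (p ^ k %| (pfree_prod p 0 (p ^ k)).+1)%N.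
Proof.
move=> p_pr p_odd k_gt0; have p_gt1 := prime_gt1 p_pr.
have p_dvd : (p %| (pfree_prod p 0 (p ^ k)).+1)%N.
  rewrite -Zp_nat_eq0 // -natr1 -(prednK k_gt0) expnS.
  rewrite pfree_prodM ?dvdnn //; last by apply/eqP; rewrite Zp_nat_eq0.
  have -> : (pfree_prod p 0 p)%:R = -1 :> 'Z_p.
    have -> : pfree_prod p 0 p = (p.-1)`!.
      by rewrite -(@pfree_prod_fact p) prednK ?leqnn ?prime_gt0.
    by apply/eqP; rewrite -subr_eq0 opprK natr1 Zp_nat_eq0 // -Wilson.
  by rewrite -signr_odd oddX p_odd orbT addNr.
have := pfree_prod_sqr p_pr k_gt0.
set W := pfree_prod _ _ _ in p_dvd *.
rewrite -[X in (_ - X)%N](exp1n 2) subn_sqr addn1 Gauss_dvdr //.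
rewrite coprime_pexpl // prime_coprime //; apply/negP => p_dvd'.
have : (p %| W.+1 - (W - 1))%N by apply: dvdn_sub.
have W_gt0 : (0 < W)%N.
  rewrite lt0n; apply/eqP => W0; move: p_dvd; rewrite W0 dvdn1; lia.
have -> : (W.+1 - (W - 1) = 2)%N by lia.
by rewrite dvdn_prime2 // => /eqP p2; rewrite p2 in p_odd.
Qed.

(** The product of the integers prime to p up to p N, for N a multiple of p^e,
    is (-1)^(p N) modulo p^[sign_exp p e].  The exponent e + 1 would be too
    large for p = 2 and e = 1: if N = 2 the product 1 * 3 is -1 modulo 4. *)
Definition sign_exp (p e : nat) : nat := if odd p then e.+1 else maxn 1 e.

Lemma sign_exp_gt1 (p e : nat) : prime p -> (1 < p ^ sign_exp p e)%N.
Proof.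
move=> p_pr; rewrite -(expn0 p) ltn_exp2l ?prime_gt1 // /sign_exp.
by case: odd; rewrite // leq_max.
Qed.

Lemma dvdn_sign_exp (p e N : nat) :
  (p ^ e %| N -> p ^ sign_exp p e %| p * N)%N.
Proof.
move=> /(dvdn_mul (dvdnn p)); rewrite -expnS; apply: dvdn_trans.
by rewrite dvdn_exp2l // /sign_exp; case: odd; lia.
Qed.

(** For p odd, p N consists of N / p^e blocks of length p^(e+1), each
    contributing -1.  For p = 2 and e > 0, 2 N consists of an even number of
    blocks of length 2^e, whose contributions square to 1; for p = 2 and e = 0
    the modulus is 2 and each block contributes 1. *)
Lemma pfree_prod_sign (p e N : nat) : prime p -> (p ^ e %| N)%N ->
  (pfree_prod p 0 (p * N))%:R = (-1) ^+ (p * N) :> 'Z_(p ^ sign_exp p e).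
Proof.
move=> p_pr dvd_N; have gt1 := sign_exp_gt1 e p_pr.
have step k (A : nat) : (0 < k)%N -> k = sign_exp p e ->
  (pfree_prod p 0 (p ^ k * A))%:R
    = (pfree_prod p 0 (p ^ k))%:R ^+ A :> 'Z_(p ^ sign_exp p e).
  move=> k_gt0 k_eq; apply: pfree_prodM; first exact: dvdn_exp.
  by apply/eqP; rewrite Zp_nat_eq0 // -k_eq.
have [A defN] := dvdnP dvd_N.
case: (boolP (odd p)) => [p_odd | p_even].
  have eE : e.+1 = sign_exp p e by rewrite /sign_exp p_odd.
  have -> : (p * N = p ^ e.+1 * A)%N by rewrite defN expnS; lia.
  rewrite step //.
  have -> : (pfree_prod p 0 (p ^ e.+1))%:R = -1 :> 'Z_(p ^ sign_exp p e).
    apply/eqP; rewrite -subr_eq0 opprK natr1 Zp_nat_eq0 // -eE.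
    exact: pfree_prod_odd.
  by rewrite -[RHS]signr_odd oddM oddX p_odd orbT signr_odd.
have p2 : p = 2%N by apply/eqP; case: (even_prime p_pr) p_even => -> // ->.
rewrite -[RHS]signr_odd oddM (negPf p_even) /= expr0.
have eE : maxn 1 e = sign_exp p e by rewrite /sign_exp (negPf p_even).
case: (posnP e) => [e0 | e_gt0].
  rewrite -[X in pfree_prod p 0 (X * N)]expn1 step //; last by rewrite -eE e0.
  rewrite expn1.
  suff -> : pfree_prod p 0 p = 1%N by rewrite expr1n.
  by rewrite p2 /pfree_prod /index_iota /= !big_cons big_nil.
have -> : (p * N = p ^ e * (2 * A))%N by rewrite defN {1}p2; lia.
rewrite step //; last by rewrite -eE (maxn_idPr e_gt0).
rewrite exprM.
suff -> : (pfree_prod p 0 (p ^ e))%:R ^+ 2 = 1 :> 'Z_(p ^ sign_exp p e).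
  by rewrite expr1n.
apply/eqP; rewrite -natrX -subr_eq0 -[X in _ - X]/1%:R -natrB; last first.
  rewrite expn_gt0 orbF lt0n; apply/eqP => P0.
  by have := coprime_pfree 0 (p ^ e) p_pr; rewrite P0 prime_coprime ?dvdn0.
rewrite Zp_nat_eq0 // -eE (maxn_idPr e_gt0).
exact: pfree_prod_sqr.
Qed.

Lemma pfree_prod_sign_fact (p e N r : nat) : prime p -> (p ^ e %| N)%N ->
  (r < p)%N ->
  (pfree_prod p 0 (p * N + r).+1)%:R
    = (-1) ^+ (p * N) * (r`!)%:R :> 'Z_(p ^ sign_exp p e).
Proof.
move=> p_pr dvd_N lt_rp.
rewrite -addnS pfree_prodD ?dvdn_mulr //; last first.
  by apply/eqP; rewrite Zp_nat_eq0 ?sign_exp_gt1 // dvdn_sign_exp.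
by rewrite pfree_prod_sign // pfree_prod_fact.
Qed.

(** * Congruences in the p-adic integers *)

Lemma padic_nat_unit (p d : nat) : prime p -> coprime p d ->
  exists z : padic_int p, d%:R * z = 1.
Proof.
move=> p_pr co_pd.
have gt1 k : (1 < p ^ k.+1)%N by rewrite -(expn0 p) ltn_exp2l ?prime_gt1.
have d_unit k : d%:R \is a @GRing.unit 'Z_(p ^ k.+1).
  by rewrite unitZpE // coprime_pexpl.
have compat k : (((d%:R : 'Z_(p ^ k.+2))^-1 : 'Z__) : nat)%:R
    = (d%:R : 'Z_(p ^ k.+1))^-1.
  apply: (mulrI (d_unit k)).
  rewrite -[LHS]/(d%:R * padic_red _) -{1}padic_red_nat -padic_redM.
  apply: (etrans (congr1 (@padic_red p k) (divrr (d_unit k.+1)))).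
  exact: (etrans (padic_compat1 p k) (esym (divrr (d_unit k)))).
exists (PadicInt compat); apply: padicP => k.
have natE x : (x%:R : padic_int p) k = x%:R.
  by elim: x => // x IHx; rewrite -[in RHS]natr1 -IHx -natr1.
rewrite -[LHS]/((d%:R : padic_int p) k * (d%:R)^-1) natE.
exact: divrr (d_unit k).
Qed.

(** Only the p-part of the modulus matters, its cofactor being a unit. *)
Lemma padic_congr_mod (p d : nat) (x y : int) : prime p -> (0 < d)%N ->
  ((p ^ logn p d)%N %| x - y)%Z ->
  congr_mod (d%:R : padic_int p) x%:~R y%:~R.
Proof.
move=> p_pr d_gt0 /dvdzP[t def_xy].
have [u co_pu def_d] := pfactor_coprime p_pr d_gt0.
have [z uz1] := padic_nat_unit p_pr co_pu.
exists (z * t%:~R); rewrite -rmorphB /= def_xy {2}def_d rmorphM natrM.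
by rewrite mulrACA uz1 mul1r mulrC.
Qed.

(** * Divisibility of the coefficients *)

Definition half_if_even (n : nat) : nat := if odd n then n else n./2.

Lemma half_if_even_gt0 (n : nat) : (0 < n)%N -> (0 < half_if_even n)%N.
Proof. by rewrite /half_if_even; case: n => [|[|n]] //; case: odd. Qed.

Lemma logn_half_if_even (p n : nat) : prime p -> (0 < n)%N ->
  logn p (half_if_even n * p) = (logn p n + (odd p || odd n))%N.
Proof.
move=> p_pr n_gt0; have p_gt0 := prime_gt0 p_pr.
rewrite lognM ?half_if_even_gt0 // [X in (_ + X)%N]logn_prime // eqxx.
rewrite /half_if_even; case: (boolP (odd n)) => [_ | n_even].
  by rewrite orbT.
have half_gt0 : (0 < n./2)%N by case: n n_gt0 n_even => [|[|n]].
have def_n : n = (n./2 * 2)%N by rewrite muln2 even_halfK.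
rewrite orbF {2}def_n lognM // [logn p 2]logn_prime //.
case: (even_prime p_pr) => [-> | p_odd]; first by rewrite addn0.
by rewrite p_odd; case: eqP p_odd => [-> | _ _]; rewrite ?addn0.
Qed.

Lemma logn_even_prime (p n : nat) : prime p -> ~~ odd p -> odd n ->
  logn p n = 0.
Proof.
move=> p_pr p_even n_odd; rewrite lognE p_pr odd_gt0 //=.
case: (even_prime p_pr) p_even => [-> _ | -> //].
by rewrite dvdn2 n_odd.
Qed.

Local Open Scope nat_scope.

(** A permutation is obtained by laying out the cycles whose length satisfies P,
    which takes w points and can be done in k^_w ways up to the symmetries of
    these cycles, and then permuting the other k - w points with the remaining
    cycle type; the number of ways of the latter is the cofactor, an integer by
    [dvdn_cycle_weight]. *)
Lemma dvdn_ffact_cycle_coef (k : nat) (m : nat -> nat) (P : pred nat) :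
  cycle_weight k m = k ->
  k ^_ (\sum_(1 <= i < k.+1 | P i) i * m i)
    %| cycle_coef k m * \prod_(1 <= i < k.+1 | P i) (i ^ m i * (m i)`!).
Proof.
move=> wk; set s := \sum_(_ <= _ < _ | _) _; set Z := \prod_(_ <= _ < _ | _) _.
pose m' i := if P i then 0 else m i.
have wk' : s + cycle_weight k m' = k.
  rewrite -[RHS]wk /cycle_weight [in RHS](bigID P) /=; congr (_ + _).
  rewrite (bigID P) /= big1 ?add0n => [|i Pi]; last by rewrite /m' Pi muln0.
  by apply: eq_bigr => i /negPf Pi; rewrite /m' Pi.
have := dvdn_cycle_weight k m'; rewrite (bigID P) /= big1 ?mul1n; last first.
  by move=> i Pi; rewrite /m' Pi.
have -> : cycle_weight k m' = k - s by rewrite -[in RHS]wk' addKn.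
rewrite (eq_bigr (fun i => i ^ m i * (m i)`!)); last first.
  by move=> i /negPf Pi; rewrite /m' Pi.
case/dvdnP => t def_t; apply/dvdnP; exists t.
have Z'_gt0 : 0 < \prod_(1 <= i < k.+1 | ~~ P i) (i ^ m i * (m i)`!).
  by move: (fact_gt0 (k - s)); rewrite def_t muln_gt0 => /andP[].
apply/eqP; rewrite -(eqn_pmul2r Z'_gt0) -mulnA.
have := cycle_coefE wk; rewrite (bigID P) /= => ->.
by rewrite mulnAC -def_t mulnC ffact_fact // -[leqRHS]wk' leq_addr.
Qed.

Lemma cycle_coef_gt0 (k : nat) (m : nat -> nat) :
  cycle_weight k m = k -> 0 < cycle_coef k m.
Proof.
by move=> /cycle_coefE wk; move: (fact_gt0 k); rewrite -wk muln_gt0 => /andP[].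
Qed.

Lemma dvdn_ffactW (n a b : nat) : a <= b -> n ^_ a %| n ^_ b.
Proof.
move=> /subnK <-; elim: (b - a) => //= d IHd.
by rewrite addSn ffactnSr dvdn_mulr.
Qed.

(** The factors of the falling factorial include the multiples n p,
    (n-1) p, ..., (n-Q) p of p. *)
Lemma dvdn_ffact_multiples (p n r w Q : nat) : 0 < p -> p * Q + r < w ->
  p ^ Q.+1 * n ^_ Q.+1 %| (r + n * p) ^_ w.
Proof.
move=> p_gt0 lt_w; apply: dvdn_trans (dvdn_ffactW _ lt_w) => {w lt_w}.
elim: Q => [|Q IHQ].
  by rewrite muln0 add0n expn1 ffactn1 ffactnSr addKn mulnC dvdn_mull.
rewrite expnSr (ffactnSr n) (ffactnSr (r + _)) mulnACA dvdn_mul //.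
  by apply: dvdn_trans IHQ (dvdn_ffactW _ _); rewrite mulnS; lia.
have -> : r + n * p - (p * Q.+1 + r) = p * (n - Q.+1) by rewrite mulnBr; lia.
exact: dvdnn.
Qed.

Lemma dvdn_fact_ffact (n a : nat) : a`! %| n ^_ a.
Proof. by rewrite -bin_ffact dvdn_mull. Qed.

(** From p^v <= M <= 2 x, with 2 x < 3^x if p is odd and 2 x <= 2^x if
    p = 2. *)
Lemma logn_leq_half (p x M : nat) : prime p -> 0 < M -> M <= x.*2 ->
  logn p M + odd p <= x.
Proof.
move=> p_pr M_gt0 le_M.
have x_gt0 : 0 < x by case: x le_M M_gt0 => //; case: M.
have {le_M}le_p : p ^ logn p M <= x.*2.
  by apply: leq_trans le_M; apply: dvdn_leq; rewrite ?pfactor_dvdnn.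
have p_gt1 := prime_gt1 p_pr.
case: (boolP (odd p)) => [p_odd | _] /=.
  rewrite addn1 -(ltn_exp2l _ _ p_gt1); apply: leq_ltn_trans le_p _.
  have p_ge3 : 2 < p by case: p p_pr p_odd {p_gt1} => [|[|[|]]].
  apply: (@leq_trans (3 ^ x)); last by rewrite leq_exp2r.
  by elim: x {x_gt0} => // x IHx; rewrite expnS; lia.
rewrite addn0 -(leq_exp2l _ _ p_gt1); apply: leq_trans le_p _.
apply: (@leq_trans (2 ^ x)); last by rewrite leq_exp2r.
elim: x x_gt0 => // -[|x] // IHx _.
by rewrite expnS; have := IHx isT; lia.
Qed.

Section Vanishing.

Variables (p n r : nat) (m : nat -> nat).
Hypotheses (p_pr : prime p) (r_lt : r < p).
Local Notation k := (r + n * p).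
Hypothesis wk : cycle_weight k m = k.
Local Notation c := (cycle_coef k m).

Lemma dvdn_ffact_cycle_coef1 (i : nat) : 0 < i <= k ->
  k ^_ (i * m i) %| c * (i ^ m i * (m i)`!).
Proof.
move=> i_range; have := dvdn_ffact_cycle_coef (pred1 i) wk.
by rewrite /= !big_nat1_eq ltnS i_range.
Qed.

(** With Q the quotient of m_i by p, the p-part p^Q Q! of m_i! is absorbed by
    the falling factorial, which moreover contains the factor n p. *)
Lemma vanish_coprime_length (i : nat) : 1 < i <= k -> ~~ (p %| i) ->
  r < i * m i -> p ^ logn p (n * p) %| c.
Proof.
case/andP=> i_gt1 le_ik ndvd_i lt_r; have p_gt0 := prime_gt0 p_pr.
have := @dvdn_ffact_cycle_coef1 i; rewrite le_ik (ltnW i_gt1) => /(_ isT).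
set Q := m i %/ p.
(* If Q > 0 then p Q <= m_i and r < p <= m_i, and i is at least 2. *)
have lt_w : p * Q + r < i * m i.
  have [-> | Q_gt0] := posnP Q; first by rewrite muln0.
  by have := leq_divM (m i) p; rewrite -/Q; nia.
move/(dvdn_trans (dvdn_ffact_multiples n p_gt0 lt_w)).
rewrite (fact_pfree _ p_gt0) -/Q => dvd_c.
have : p ^ Q * Q`! * (n * p)
    %| p ^ Q * Q`! * (c * (i ^ m i * pfree_prod p 0 (m i).+1)).
  have -> : p ^ Q * Q`! * (n * p) = p ^ Q.+1 * (n * Q`!) by rewrite expnS; lia.
  have -> : p ^ Q * Q`! * (c * (i ^ m i * pfree_prod p 0 (m i).+1))
    = c * (i ^ m i * (p ^ Q * Q`! * pfree_prod p 0 (m i).+1)) by lia.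
  apply: dvdn_trans dvd_c.
  by rewrite ffactnS dvdn_mul // dvdn_mul // dvdn_fact_ffact.
rewrite dvdn_pmul2l ?muln_gt0 ?expn_gt0 ?p_gt0 ?fact_gt0 //.
move/(dvdn_trans (pfactor_dvdnn p _)); rewrite Gauss_dvdl //.
apply: coprimeXl; rewrite coprimeMr coprime_pfree // coprimeXr //.
by rewrite prime_coprime.
Qed.

(** Here the lengths other than 1 and p that occur, and their multiplicities,
    are at most r < p, so the product of their i^m_i m_i! is prime to p. *)
Lemma vanish_short_lengths :
  (forall i, 0 < i <= k -> i != 1 -> i != p -> i * m i <= r) ->
  r < \sum_(1 <= i < k.+1 | (i != 1) && (i != p)) i * m i ->
  p ^ logn p (n * p) %| c.
Proof.
move=> le_r lt_r; have p_gt0 := prime_gt0 p_pr.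
have := dvdn_ffact_cycle_coef [pred i | (i != 1) && (i != p)] wk => /=.
have lt_w : p * 0 + r < \sum_(1 <= i < k.+1 | (i != 1) && (i != p)) i * m i.
  by rewrite muln0.
move/(dvdn_trans (dvdn_ffact_multiples n p_gt0 lt_w)).
rewrite expn1 ffactn1 mulnC => /(dvdn_trans (pfactor_dvdnn p _)).
rewrite Gauss_dvdl //; apply: coprimeXl.
rewrite big_nat_cond; elim/big_ind: _ => [|x y|i]; first exact: coprimen1.
  by rewrite coprimeMr => -> ->.
rewrite ltnS => /andP[i_range /andP[i_neq1 i_neqp]].
have le_i := le_r i i_range i_neq1 i_neqp.
have [-> | m_gt0] := posnP (m i); first exact: coprimen1.
have co_small x : 0 < x <= r -> coprime p x.
  case/andP=> x_gt0 le_x; rewrite prime_coprime //; apply/negP => /dvdn_leq.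
  by rewrite x_gt0 => /(_ isT); lia.
rewrite coprimeMr coprimeXr; last by apply: co_small; nia.
have le_m : m i <= r by nia.
rewrite -(@pfree_prod_fact p) ?coprime_pfree //; lia.
Qed.

Hypothesis n_gt0 : 0 < n.

(** Write i = p j, N = m_i, M = j N and x = (j-1) N.  The falling factorial
    contributes p^M n^_M, while i^N N! costs at most p^N M!.  As n^_M is
    divisible both by M! and by n (M-1)!, the valuation of the coefficient is
    at least x and at least x + v(n) - v(M), where M <= 2 x.  The first bound
    serves for p = 2 and n odd, the second one otherwise. *)
Lemma vanish_multiple_length (i : nat) : 0 < i <= k -> p %| i -> i != p ->
  r < i * m i -> p ^ logn p (half_if_even n * p) %| c.
Proof.
move=> i_range /dvdnP[j def_i] i_neq lt_r; have p_gt0 := prime_gt0 p_pr.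
have := dvdn_ffact_cycle_coef1 i_range.
have j_gt1 : 1 < j.
  by case: j def_i => [|[|]] //; lia.
set N := m i in lt_r *.
have N_gt0 : 0 < N by case: N lt_r => //; rewrite muln0.
set M := j * N; set x := (j.-1) * N.
have M_gt0 : 0 < M by rewrite muln_gt0 N_gt0 ltnW.
have x_gt0 : 0 < x by rewrite muln_gt0 N_gt0 -subn1 subn_gt0 j_gt1.
have defM : M = x + N by rewrite /M /x; nia.
have lt_w : p * M.-1 + r < i * N by rewrite def_i; nia.
move/(dvdn_trans (dvdn_ffact_multiples n p_gt0 lt_w)); rewrite prednK //.
have -> : i ^ N * N`! = p ^ N * (j ^ N * N`!) by rewrite def_i expnMn; lia.
move=> dvd_c.
have : p ^ N * (p ^ x * n ^_ M) %| p ^ N * (c * M`!).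
  have -> : p ^ N * (p ^ x * n ^_ M) = p ^ M * n ^_ M.
    by rewrite mulnA -expnD addnC defM.
  apply: dvdn_trans dvd_c _; rewrite mulnCA dvdn_mul // dvdn_mul //.
  exact: dvdn_expn_fact (ltnW j_gt1).
rewrite dvdn_pmul2l ?expn_gt0 ?p_gt0 // => {}dvd_c.
have c_gt0 := cycle_coef_gt0 wk.
have le_x : x <= logn p c.
  rewrite -pfactor_dvdn // -(dvdn_pmul2r (fact_gt0 M)).
  by apply: dvdn_trans dvd_c; rewrite dvdn_mul // dvdn_fact_ffact.
have le_xn : x + logn p n <= logn p c + logn p M.
  rewrite -lognM // -pfactor_dvdn ?[0 < c * M]muln_gt0 ?c_gt0 // expnD.
  apply: dvdn_trans (dvdn_mul (dvdnn _) (pfactor_dvdnn p n)) _.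
  have factM : M * (M.-1)`! = M`! by rewrite -{1}(prednK M_gt0) -factS prednK.
  rewrite -(dvdn_pmul2r (fact_gt0 M.-1)) -[c * M * _]mulnA factM.
  apply: dvdn_trans dvd_c; rewrite -mulnA dvdn_mul //.
  by rewrite -{2}(prednK M_gt0) ffactnS dvdn_mul // dvdn_fact_ffact.
rewrite pfactor_dvdn // logn_half_if_even //.
have le_M : M <= x.*2 by rewrite /M /x; nia.
have := logn_leq_half p_pr M_gt0 le_M.
case: (boolP (odd p)) => [_ | p_even] /=; first by lia.
case: (boolP (odd n)) => [n_odd | _] /=; last by lia.
suff -> : logn p n = 0 by lia.
exact: logn_even_prime.
Qed.

End Vanishing.

(** * The main case *)

Lemma big_nat_isolate2 (R : Type) (idx : R) (op : Monoid.com_law idx)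
    (p k : nat) (F : nat -> R) : 1 < p <= k ->
  \big[op/idx]_(1 <= i < k.+1) F i
    = op (F 1) (op (F p)
        (\big[op/idx]_(1 <= i < k.+1 | (i != 1) && (i != p)) F i)).
Proof.
case/andP=> p_gt1 le_pk.
rewrite (bigID (pred1 1)) /= big_nat1_eq /= ltnS (leq_trans (ltnW p_gt1) le_pk).
congr (op _ _); rewrite (bigID (pred1 p)) /=; congr (op _ _).
rewrite (eq_bigl (pred1 p)) ?big_nat1_eq ?ltnS ?le_pk ?(ltnW p_gt1) // => i /=.
have p_neq1 : p != 1 by rewrite neq_ltn p_gt1 orbT.
by case: (i =P p) => [-> | _]; rewrite ?andbF ?p_neq1.
Qed.

Section MainCase.

Variables (p n r : nat) (m : nat -> nat).
Hypotheses (p_pr : prime p) (n_gt0 : 0 < n).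
Local Notation k := (r + n * p).
Hypothesis wk : cycle_weight k m = k.
Local Notation s := (\sum_(1 <= i < k.+1 | (i != 1) && (i != p)) i * m i).
Local Notation c := (cycle_coef k m).

Lemma le_p_weight : 1 < p <= k.
Proof.
by rewrite prime_gt1 // (leq_trans _ (leq_addl r _)) // leq_pmull.
Qed.

Lemma weight_split : m 1 + (p * m p + s) = k.
Proof.
by rewrite -[RHS]wk /cycle_weight (big_nat_isolate2 _ _ le_p_weight) /= mul1n.
Qed.

Hypotheses (r_gt0 : 0 < r) (r_lt : r < p) (le_sr : s <= r).
Let u := m 1 + p * m p - n * p.
Let m' i := if i == 1 then u else m i.

Lemma other_length_le (i : nat) :
  0 < i <= k -> i != 1 -> i != p -> i * m i <= r.
Proof.
move=> i_range i_neq1 i_neqp; apply: leq_trans le_sr.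
rewrite (big_rem i) /= ?mem_index_iota ?ltnS // i_neq1 i_neqp.
exact: leq_addr.
Qed.

(** As i m_i <= r for every i other than 1 and p, the lengths beyond r do not
    occur in m, apart from p.  Hence the weight and the denominator of the
    coefficient attached to m' are those of m, with u in place of m_1 and the
    length p left out. *)
Lemma big_reduced (R : Type) (idx : R) (op : Monoid.com_law idx)
    (G : nat -> nat -> R) : (forall i, G i 0 = idx) ->
  \big[op/idx]_(1 <= i < r.+1) G i (m' i)
    = op (G 1 u)
        (\big[op/idx]_(1 <= i < k.+1 | (i != 1) && (i != p)) G i (m i)).
Proof.
move=> G0; pose m'' i := if i == p then 0 else m' i.
have -> : \big[op/idx]_(1 <= i < r.+1) G i (m' i)
    = \big[op/idx]_(1 <= i < k.+1) G i (m'' i).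
  rewrite [RHS](@big_cat_nat _ _ _ r.+1) //= ?ltnS ?leq_addr //.
  rewrite [X in op _ X]big1_seq ?Monoid.mulm1 => [|i].
    apply: eq_big_nat => i /andP[_ le_ir]; rewrite /m''.
    by rewrite ifF //; apply/eqP; lia.
  rewrite andTb mem_index_iota ltnS => /andP[lt_ri le_ik].
  rewrite /m'' /m'; case: (i =P p) => [// | /eqP i_neqp].
  have i_neq1 : i != 1 by lia.
  rewrite (negPf i_neq1); have -> // : m i = 0.
  have := @other_length_le i; rewrite le_ik i_neq1 i_neqp; nia.
rewrite (big_nat_isolate2 _ _ le_p_weight) /m'' /m' !eqxx G0 Monoid.mul1m.
rewrite ifF; last by apply/eqP; have := prime_gt1 p_pr; lia.
congr (op _ _); apply: eq_bigr => i /andP[/negPf-> /negPf->].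
by [].
Qed.

Let l := m p.
Let Z := \prod_(1 <= i < k.+1 | (i != 1) && (i != p)) (i ^ m i * (m i)`!).

Lemma le_ln : l <= n.
Proof. by have := weight_split; have := prime_gt0 p_pr; rewrite /l; nia. Qed.

Lemma m1E : m 1 = p * (n - l) + u.
Proof.
rewrite mulnBr /u; have := weight_split; have := leq_mul (leqnn p) le_ln.
by rewrite /l; lia.
Qed.

Lemma reduced_weight : u + s = r.
Proof.
by have := weight_split; have := m1E; have := le_ln; rewrite /l; nia.
Qed.

Lemma reduced_cycle_coefE : cycle_coef r m' * (u`! * Z) = r`!.
Proof.
rewrite -(cycle_coefE (k := r) (a := m')); last first.
  rewrite /cycle_weight (big_reduced _ (G := muln) muln0) /= mul1n.
  exact: reduced_weight.
congr (_ * _); rewrite (big_reduced _ (G := fun i a => i ^ a * a`!)) //.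
by rewrite exp1n mul1n.
Qed.

(** The factor p^n n! of k! cancels against p^m_p m_p! and the factor
    p^(n - m_p) (n - m_p)! of m_1!, up to the binomial coefficient. *)
Lemma cycle_coef_pfree :
  c * (pfree_prod p 0 (m 1).+1 * Z)
    = 'C(n, l) * pfree_prod p 0 (p * n + r).+1.
Proof.
have p_gt0 := prime_gt0 p_pr.
have := cycle_coefE wk; rewrite (big_nat_isolate2 _ _ le_p_weight) /= -/l -/Z.
rewrite exp1n mul1n (fact_pfree _ p_gt0) (fact_pfree k p_gt0).
have -> : k %/ p = n by rewrite addnC divnMDl // divn_small // addn0.
have -> : m 1 %/ p = n - l.
  rewrite {1}m1E mulnC divnMDl // divn_small ?addn0 //.
  by have := reduced_weight; lia.
have -> : p ^ n = p ^ l * p ^ (n - l) by rewrite -expnD subnKC ?le_ln.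
rewrite -[in n`!](bin_fact le_ln) => cE.
apply/eqP; rewrite [p * n]mulnC [n * p + r]addnC.
rewrite -(@eqn_pmul2l (p ^ l * p ^ (n - l) * (l`! * (n - l)`!))); last first.
  by rewrite !muln_gt0 !expn_gt0 p_gt0 !fact_gt0.
apply/eqP; transitivity (p ^ l * p ^ (n - l) * ('C(n, l) * (l`! * (n - l)`!))
    * pfree_prod p 0 k.+1); last by ring.
by rewrite -cE; ring.
Qed.

Lemma coprime_Z : coprime p (u`! * Z).
Proof.
apply: (@coprime_dvdr _ r`!).
  by rewrite -reduced_cycle_coefE dvdn_mull.
by rewrite -(pfree_prod_fact r_lt) coprime_pfree.
Qed.

Local Open Scope ring_scope.

(** Multiplication by the integer U(m_1) u! Z, prime to p, turns the difference
    into the product of 'C(n, l) and B := U(k) u! - (-1)^(p l) r! U(m_1).  If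
    p^e is the greatest common divisor of l and the p-part of n, then that
    p-part divides p^e 'C(n, l), and p^[sign_exp p e] divides B because both of
    its terms are (-1)^(p n) r! u! modulo that power. *)
Lemma cycle_coef_congr :
  ((p ^ logn p (half_if_even n * p))%N
     %| c%:Z - (-1) ^+ (p * l) * ('C(n, l))%:Z * (cycle_coef r m')%:Z)%Z.
Proof.
have [e le_e gcd_e] := dvdn_pfactor (gcdn (p ^ logn p n) l) (logn p n) p_pr
  (dvdn_gcdl _ _).
have e_l : (p ^ e %| l)%N by rewrite -gcd_e dvdn_gcdr.
have e_n : (p ^ e %| n)%N.
  by apply: dvdn_trans (pfactor_dvdnn p n); rewrite -gcd_e dvdn_gcdl.
have n_bin : (p ^ logn p n %| 'C(n, l) * p ^ e)%N.
  rewrite -gcd_e muln_gcdr dvdn_gcd dvdn_mull //=.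
  case: (posnP l) => [-> | l_gt0]; first by rewrite muln0.
  rewrite -(prednK l_gt0) -(prednK n_gt0) mulnC -mul_bin_diag dvdn_mulr //.
  by rewrite prednK // pfactor_dvdnn.
pose U1 := pfree_prod p 0 (m 1%N).+1; pose U2 := pfree_prod p 0 (p * n + r).+1.
pose B := U2%:Z * (u`!)%:Z - (-1) ^+ (p * l) * (r`!)%:Z * U1%:Z.
have dvd_B : ((p ^ sign_exp p e)%N %| B)%Z.
  rewrite -Zp_int_eq0 ?sign_exp_gt1 // /B rmorphB !rmorphM rmorphXn rmorphN1 /=.
  rewrite -!pmulrn /U1 /U2 m1E !(pfree_prod_sign_fact p_pr) ?dvdn_sub //;
    last first.
    by have := reduced_weight; lia.
  have -> : (p * n = p * l + p * (n - l))%N by rewrite -mulnDr subnKC ?le_ln.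
  by rewrite exprD; apply/eqP; ring.
set X := _ - _.
have XE : X * (U1 * (u`! * Z))%N%:Z = 'C(n, l)%:Z * B.
  have E1 : c%:Z * (U1%:Z * Z%:Z) = 'C(n, l)%:Z * U2%:Z.
    by rewrite -!PoszM cycle_coef_pfree.
  have E2 : (cycle_coef r m')%:Z * ((u`!)%:Z * Z%:Z) = (r`!)%:Z.
    by rewrite -!PoszM reduced_cycle_coefE.
  rewrite /X /B -E2 !PoszM.
  transitivity (c%:Z * (U1%:Z * Z%:Z) * (u`!)%:Z - (-1) ^+ (p * l)
    * 'C(n, l)%:Z * ((cycle_coef r m')%:Z * ((u`!)%:Z * Z%:Z)) * U1%:Z).
    by ring.
  by rewrite E1; ring.
have co : coprimez (p ^ logn p (half_if_even n * p))%N (U1 * (u`! * Z))%N.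
  rewrite coprimezE !absz_nat; apply: coprimeXl.
  by rewrite coprimeMr coprime_pfree // coprime_Z.
rewrite -(Gauss_dvdzl _ co) XE.
have pe_gt0 : (0 < p ^ e)%N by rewrite expn_gt0 prime_gt0.
rewrite dvdzE abszM !absz_nat -(dvdn_pmul2r pe_gt0) mulnAC.
apply: dvdn_trans (dvdn_mul n_bin dvd_B); rewrite -!expnD dvdn_exp2l //.
(* What is left is v(n* p) + e <= v(n) + sign_exp p e.  If p = 2 and n is odd,
   then e = 0 and both sides are 1. *)
rewrite logn_half_if_even // /sign_exp.
case: (boolP (odd p)) => [_ | p_even] /=; first by rewrite addn1 addSnnS.
case: (boolP (odd n)) le_e => [n_odd | _ _] /=.
  by rewrite (logn_even_prime p_pr p_even n_odd) leqn0 => /eqP->.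
by rewrite addn0 leq_add2l leq_maxr.
Qed.

End MainCase.

(** * The congruences *)

Local Open Scope ring_scope.

Lemma cycle_coef_vanish (p n r : nat) (m : nat -> nat) :
  prime p -> (0 < n)%N -> (0 < r < p)%N ->
  cycle_weight (r + n * p) m = (r + n * p)%N ->
  (r < \sum_(1 <= i < (r + n * p).+1 | (i != 1) && (i != p)) i * m i)%N ->
  (p ^ logn p (half_if_even n * p) %| cycle_coef (r + n * p) m)%N.
Proof.
move=> p_pr n_gt0 /andP[r_gt0 r_lt] wk lt_rs.
have p_gt0 := prime_gt0 p_pr.
have weaken d :
  (p ^ logn p (n * p) %| d -> p ^ logn p (half_if_even n * p) %| d)%N.
  apply: dvdn_trans; rewrite dvdn_exp2l // dvdn_leq_log ?muln_gt0 ?n_gt0 //.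
  rewrite dvdn_pmul2r // /half_if_even; case: (boolP (odd n)) => // n_even.
  by rewrite -{2}(even_halfK n_even) -muln2 dvdn_mulr.
case: (boolP (has (fun i => [&& i != 1, i != p & r < i * m i]%N)
  (index_iota 1 (r + n * p).+1))) => [/hasP[i]|/hasPn short].
  rewrite mem_index_iota ltnS => i_range /and3P[i_neq1 i_neqp lt_ri].
  case: (boolP (p %| i)%N) => [p_dvd | p_ndvd].
    exact: (vanish_multiple_length p_pr r_lt wk n_gt0 i_range).
  apply: weaken; apply: (vanish_coprime_length p_pr r_lt wk _ p_ndvd lt_ri).
  by case/andP: i_range => i_gt0 ->; rewrite ltn_neqAle eq_sym i_neq1 i_gt0.
apply: weaken; apply: (vanish_short_lengths p_pr r_lt wk) => // i i_range.
move=> i_neq1 i_neqp; rewrite leqNgt.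
by have := short i; rewrite mem_index_iota ltnS i_range i_neq1 i_neqp; apply.
Qed.

Theorem mainTheorem2 (p n r : nat) (m : nat -> nat)
    (p_prime : prime p) (n_gt0 : (0 < n)%N) (r_range : (1 <= r <= p - 1)%N)
    (m_weight : (r + n * p)%N = (\sum_(1 <= i < (r + n * p).+1) i * m i)%N) :
  let nstar := if odd n then n else n./2 in
  let modulus : padic_int p := (nstar * p)%:R in
  let c : padic_int p := (cycle_coef (r + n * p) m)%:R in
  let m' := fun i : nat =>
    if i == 1%N then (m 1 + p * m p - n * p)%N else m i in
  let main_case : bool :=
    0 <= p%:Z * (n%:Z - (m p)%:Z) <= (m 1%N)%:Z in
  (main_case ->
     congr_mod modulus c
       ((-1) ^+ (p * m p) * 'C(n, m p)%:R * (cycle_coef r m')%:R))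
  /\ (~~ main_case -> congr_mod modulus c 0).
Proof.
move=> nstar modulus c m' main_case.
have p_gt0 := prime_gt0 p_prime.
have r_bounds : (0 < r < p)%N by lia.
have [r_gt0 r_lt] := andP r_bounds.
have wk : cycle_weight (r + n * p) m = (r + n * p)%N by [].
have mod_gt0 : (0 < half_if_even n * p)%N.
  by rewrite muln_gt0 half_if_even_gt0.
have := weight_split p_prime n_gt0 wk.
set s := (\sum_(_ <= _ < _ | _) _)%N => split_wk.
have main_caseE : main_case = (s <= r)%N.
  rewrite /main_case; have [le_ln | lt_nl] := leqP (m p) n.
    rewrite subzn // -PoszM !lez_nat mulnBr leq0n /=.
    by have := leq_mul (leqnn p) le_ln; lia.
  (* In fact n < m_p cannot happen, as p m_p >= n p + p would exceed k. *)
  have := leq_mul (leqnn p) lt_nl; rewrite mulnS => lt_pl.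
  have -> : (s <= r)%N = false by lia.
  by rewrite pmulr_rge0 ?ltz_nat // subr_ge0 lez_nat leqNgt lt_nl.
rewrite main_caseE; split => [le_sr | ]; last rewrite -ltnNge => lt_rs.
  have := padic_congr_mod p_prime mod_gt0
    (cycle_coef_congr p_prime n_gt0 wk r_gt0 r_lt le_sr).
  by rewrite !intrM rmorphXn rmorphN1; apply.
apply: (padic_congr_mod (x := (cycle_coef (r + n * p) m)%:Z) (y := 0)
  p_prime mod_gt0).
by rewrite subr0 dvdzE; apply: cycle_coef_vanish.
Qed.
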